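(* The set of strongly invisible compact subsets of $\mathbb{R}$ is dense in $\mathcal{C}(\mathbb{R})$.
   Context: $\mathcal{C}(\mathbb{R})$ is the space of all (nonempty) compact subsets of $\mathbb{R}$ with the Hausdorff metric. A translation invariant Borel measure on $\mathbb{R}$ is a countably additive measure $\mu$ on the Borel sets of $\mathbb{R}$ with values in $[0,\infty]$ (not assumed $\sigma$-finite) such that $\mu(A+t)=\mu(A)$ for all Borel $A$ and all $t\in\mathbb{R}$. A Borel set $M\subseteq\mathbb{R}$ is strongly invisible if for every translation invariant Borel measure $\mu$ on $\mathbb{R}$, either $\mu(M)=0$ or $M$ is not $\sigma$-finite with respect to $\mu$ (i.e. $M$ is not a countable union of Borel sets of finite $\mu$-measure). *)

(* Defs.v *)
From HB Require Import structures.
From mathcomp Require Import all_boot all_order all_algebra.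
From mathcomp Require Import all_classical all_reals all_analysis.

Set Implicit Arguments.
Unset Strict Implicit.
Unset Printing Implicit Defensive.

Import Order.TTheory GRing.Theory Num.Theory.
Import numFieldNormedType.Exports.

Local Open Scope classical_set_scope.
Local Open Scope ring_scope.

Record compacts (R : realType) := Compacts {
  compacts_set :> set R ;
  compacts_compact : compact compacts_set ;
  compacts_neq0 : compacts_set !=set0 }.

(* Both operations below use the real-valued [inf] and [sup], which have default
   values on empty or unbounded sets; they are only used on nonempty compact
   sets, where the infimum and the suprema exist. *)
Definition dist_to_set (R : realType) (x : R) (A : set R) : R :=
  inf [set `|x - y| | y in A].

Definition hausdorff_dist (R : realType) (A B : set R) : R :=
  Num.max (sup [set dist_to_set x B | x in A])
          (sup [set dist_to_set y A | y in B]).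

Section hausdorff_metric.
Context {R : realType}.
Implicit Types (x y z e : R) (K L M : compacts R).

Lemma compacts_inj K L : K = L :> set R -> K = L.
Proof.
case: K L => [K cK K0] [L cL L0] /= KL; move: cK K0; rewrite KL => cK K0.
by congr Compacts; exact: Prop_irrelevance.
Qed.

Lemma has_inf_dist x K : has_inf [set `|x - y| | y in K].
Proof.
split; first by have [y Ky] := compacts_neq0 K; exists `|x - y|; exists y.
by exists 0 => _ [y _ <-].
Qed.

Lemma dist_to_set_le x y K : compacts_set K y -> dist_to_set x K <= `|x - y|.
Proof. by move=> Ky; apply: ge_inf; [case: (has_inf_dist x K)|exists y]. Qed.

Lemma le_dist_to_set x K e :
  (forall y, compacts_set K y -> e <= `|x - y|) -> e <= dist_to_set x K.
Proof.
move=> eK; apply: lb_le_inf; first by case: (has_inf_dist x K).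
by move=> _ [y Ky <-]; exact: eK.
Qed.

Lemma dist_to_set_ge0 x K : 0 <= dist_to_set x K.
Proof. exact: le_dist_to_set. Qed.

Lemma dist_to_set_in x K : compacts_set K x -> dist_to_set x K = 0.
Proof.
move=> Kx; apply/eqP; rewrite eq_le dist_to_set_ge0 andbT.
by rewrite (le_trans (dist_to_set_le x Kx))// subrr normr0.
Qed.

Lemma dist_to_set_eq0 x K : dist_to_set x K = 0 -> compacts_set K x.
Proof.
move=> d0; have : closed K.
  by apply: compact_closed; [exact: Rhausdorff|exact: compacts_compact].
rewrite closure_id => ->; move=> B /nbhs_ballP[e /= e0 eB].
have : dist_to_set x K < e by rewrite d0.
move=> /(inf_lt (has_inf_dist x K).1)[_ [y Ky <-] xye].
by exists y; split => //; exact: eB.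
Qed.

Lemma has_sup_dist K L : has_sup [set dist_to_set x L | x in K].
Proof.
split.
  by have [x Kx] := compacts_neq0 K; exists (dist_to_set x L); exists x.
have [y Ly] := compacts_neq0 L.
have [B [_ KB]] := compact_bounded (@compacts_compact _ K).
exists ((B + 1) + `|y|) => _ [x Kx <-].
rewrite (le_trans (dist_to_set_le x Ly))// (le_trans (ler_normB _ _))//.
by rewrite lerD2r; apply: (KB (B + 1)) => //; rewrite ltrDl.
Qed.

Lemma hausdorff_dist_leP K L e :
  hausdorff_dist K L <= e <->
  (forall x, compacts_set K x -> dist_to_set x L <= e) /\
  (forall y, compacts_set L y -> dist_to_set y K <= e).
Proof.
have supP (A B : compacts R) : sup [set dist_to_set x B | x in A] <= e <->
    (forall x, compacts_set A x -> dist_to_set x B <= e).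
  split=> [le_e x Ax|le_e].
    apply: le_trans le_e; apply: ub_le_sup; first by case: (has_sup_dist A B).
    by exists x.
  apply: ge_sup; first by case: (has_sup_dist A B).
  by move=> _ [x Ax <-]; exact: le_e.
rewrite /hausdorff_dist ge_max; split.
  by move=> /andP[/supP ? /supP].
by move=> [/supP ? /supP ?]; exact/andP.
Qed.

Lemma hausdorff_distxx K : hausdorff_dist K K = 0.
Proof.
have K0 x : compacts_set K x -> dist_to_set x K <= 0.
  by move=> /dist_to_set_in ->.
apply/eqP; rewrite eq_le; apply/andP; split; first exact/hausdorff_dist_leP.
have [x Kx] := compacts_neq0 K.
have /hausdorff_dist_leP[/(_ x Kx) + _] := lexx (hausdorff_dist K K).
exact/le_trans/dist_to_set_ge0.
Qed.

Lemma hausdorff_dist_positivity K L : hausdorff_dist K L = 0 -> K = L.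
Proof.
move=> KL0; have /hausdorff_dist_leP[KL LK] : hausdorff_dist K L <= 0.
  by rewrite KL0.
apply: compacts_inj; apply/seteqP; split => x => [/KL|/LK] x0;
  by apply: dist_to_set_eq0; apply/eqP; rewrite eq_le x0 dist_to_set_ge0.
Qed.

Lemma hausdorff_dist_sym K L : hausdorff_dist K L = hausdorff_dist L K.
Proof. by rewrite /hausdorff_dist maxC. Qed.

Lemma dist_to_set_triangle x K L e :
  (forall y, compacts_set K y -> dist_to_set y L <= e) ->
  dist_to_set x L <= dist_to_set x K + e.
Proof.
move=> KLe; rewrite -lerBlDr; apply: le_dist_to_set => y Ky.
rewrite lerBlDr -lerBlDl.
apply: (le_trans _ (KLe y Ky)); apply: le_dist_to_set => z Lz.
by rewrite lerBlDl (le_trans (dist_to_set_le x Lz))// ler_distD.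
Qed.

Lemma hausdorff_dist_triangle L K M :
  hausdorff_dist K M <= hausdorff_dist K L + hausdorff_dist L M.
Proof.
have /hausdorff_dist_leP[KL LK] := lexx (hausdorff_dist K L).
have /hausdorff_dist_leP[LM ML] := lexx (hausdorff_dist L M).
apply/hausdorff_dist_leP; split => [x Kx|y My].
  by rewrite (le_trans (dist_to_set_triangle x LM))// lerD2r KL.
by rewrite (le_trans (dist_to_set_triangle y LK))// addrC lerD2l ML.
Qed.

HB.instance Definition _ := gen_eqMixin (compacts R).
HB.instance Definition _ := gen_choiceMixin (compacts R).
HB.instance Definition _ := @isMetric.Build R (compacts R)
  (fun K L => hausdorff_dist K L) hausdorff_distxx hausdorff_dist_positivity
  hausdorff_dist_sym hausdorff_dist_triangle.

End hausdorff_metric.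

(* [measurableTypeR R] carries the sigma-algebra generated by the intervals
   `]a, b], that is, the Borel sets of the real line. *)
Definition translation_invariant (R : realType)
    (mu : {measure set (measurableTypeR R) -> \bar R}) : Prop :=
  forall (A : set (measurableTypeR R)) (t : R),
    measurable A -> mu [set x + t | x in A] = mu A.

Definition strongly_invisible (R : realType)
    (M : set (measurableTypeR R)) : Prop :=
  measurable M /\
  forall mu : {measure set (measurableTypeR R) -> \bar R},
    translation_invariant mu -> mu M = 0%E \/ ~ sigma_finite M mu.

(* Main.v *)
(* Let f(x) = sum_k x_k 3^-k for 0/1 sequences x, and let I_n be the set of
   k with 2-adic valuation n.  Let S_N be the closed set of sequences x such
   that, for x nonzero, its first nonzero position n is >= N and x vanishes on
   I_m for all m >= n.  Then f(S_N) is compact and close to 0.  It is a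
   countable union of pieces D: those x vanishing before n and on all I_m with
   m >= n, and having a given digit at n.  Clearing the digit n of x and
   inserting arbitrary digits y at the positions k > n of I_n keeps x in S_N
   (its first nonzero position is now beyond n), and acts on f(x) as a
   translation depending only on y; different y give disjoint translates of
   f(D).  So f(S_N) contains uncountably many disjoint translates of f(D),
   hence f(D) is null as soon as f(S_N) is sigma-finite.  Finite unions of
   translates of f(S_N) are then strongly invisible, and attaching small copies
   of f(S_N) to the points of a finite net approximates any compact set. *)
Require Import Defs.
From mathcomp Require Import all_boot all_order all_algebra.
From mathcomp Require Import all_classical all_reals all_analysis.
From mathcomp Require Import measurable_realfun finmap lra.
Set Implicit Arguments.
Unset Strict Implicit.
Unset Printing Implicit Defensive.
Import Order.TTheory GRing.Theory Num.Theory.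
Import numFieldNormedType.Exports.
Local Open Scope classical_set_scope.
Local Open Scope ring_scope.

(** * Uncountable disjoint families in sigma-finite sets *)

Lemma uncountable_cantor_space : ~ countable [set: cantor_space].
Proof.
move/countable_injP => [h hinj].
(* Cantor's diagonal: [h] being injective, [d] negates at [n] the digit [n] of the sequence coded by
   [n]. *)
pose d n := `[< forall x : cantor_space, h x = n -> x n = false >].
have dE : d (h d) = false.
  apply/negbTE/negP => dd; have := dd; move/asboolP/(_ d erefl); by rewrite dd.
suff : d (h d) by rewrite dE.
by apply/asboolP => x /hinj -> //; exact: mem_set.
Qed.

Section uncountable_families.
Context d (T : measurableType d) (R : realType).
Variable mu : {measure set T -> \bar R}.

(** More than [k.+1 * mu F] disjoint pieces of mass at least [1 / k.+1] cannot fit into [F]. *)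
Lemma finite_disjoint_large (I : choiceType) (A : I -> set T) (F : set T) k :
  measurable F -> (mu F < +oo)%E -> (forall i, measurable (A i)) ->
  trivIset setT A ->
  finite_set [set i | ((k.+1%:R^-1)%:E <= mu (A i `&` F))%E].
Proof.
move=> mF Foo mA tA; apply: contrapT => inf.
have Ffin : mu F \is a fin_num by rewrite ge0_fin_numE.
pose n := Num.bound (k.+1%:R * fine (mu F)).
have [B BA nB] := infinite_set_fset n inf.
have mAF i : measurable (A i `&` F) by exact: measurableI.
have : (mu (\big[setU/set0]_(i <- B) (A i `&` F)) <= mu F)%E.
  apply: le_measure; [|exact: mem_set|].
    by apply: mem_set; exact: bigsetU_measurable.
  by rewrite -bigcup_seq => x [i _ []].
rewrite measure_fbigsetU//; last first.
  by move=> a b _ _ [x [[Aax _] [Abx _]]]; apply: tA => //; exists x.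
apply/negP; rewrite -ltNge.
apply: (@lt_le_trans _ _ (\sum_(i <- B) (k.+1%:R^-1)%:E)%E); last first.
  by rewrite !big_seq; apply: lee_sum => i iB; exact: BA.
rewrite sumEFin big_const_seq count_predT iter_addr_0 -(fineK Ffin) lte_fin.
rewrite -[X in _ < X]mulr_natl ltr_pdivlMr ?ltr0n// mulrC.
apply: lt_le_trans (archi_boundP _) _; first by rewrite mulr_ge0// fine_ge0.
by rewrite ler_nat.
Qed.

(** Otherwise each [A i] meets some [F n] in mass at least some [1 / k.+1]; each pair [(n, k)]
    serves only finitely many [i], so [I] would be countable. *)
Lemma uncountable_disjoint_null (I : choiceType) (A : I -> set T) (M : set T) :
  ~ countable [set: I] -> (forall i, measurable (A i)) -> trivIset setT A ->
  (forall i, A i `<=` M) -> sigma_finite M mu -> exists i, mu (A i) = 0.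
Proof.
move=> ucI mA tA AM [F MF mF]; apply: contrapT => /forallNP A0; apply: ucI.
pose L n k := [set i | ((k.+1%:R^-1)%:E <= mu (A i `&` F n))%E].
apply: (@sub_countable _ _ _ (\bigcup_n \bigcup_k L n k)); last first.
  do 2 (apply: bigcup_countable => [|? _]; first exact: countableP).
  apply/finite_set_countable/finite_disjoint_large => //.
    exact: (mF _).1.
  exact: (mF _).2.
apply: subset_card_le => i _; apply: contrapT => notL; apply: (A0 i).
apply: measure_negligible => //.
have -> : A i = \bigcup_n (A i `&` F n).
  by rewrite -setI_bigcupr -MF; apply/esym/setIidl/AM.
apply: negligible_bigcup => n.
have mAF : measurable (A i `&` F n).
  by apply: measurableI => //; exact: (mF n).1.
apply/negligibleP => //; apply: contrapT => /eqP AF_neq0.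
have AF0 : (0 < mu (A i `&` F n))%E by rewrite measure_gt0.
have fAF : mu (A i `&` F n) \is a fin_num.
  rewrite ge0_fin_numE//; apply: le_lt_trans (mF n).2.
  by apply: le_measure; [exact/mem_set|exact/mem_set/(mF n).1|exact: subIsetr].
apply: notL; exists n => //.
move: AF0; rewrite -(fineK fAF) lte_fin => /ltr_add_invr[k].
rewrite add0r => kA.
by exists k => //=; rewrite /L/= -(fineK fAF) lee_fin ltW.
Qed.

Lemma sigma_finite_subset (A B : set T) :
  measurable A -> A `<=` B -> sigma_finite B mu -> sigma_finite A mu.
Proof.
move=> mA AB [F BF mF]; exists (fun n => A `&` F n).
  by rewrite -setI_bigcupr -BF; apply/esym/setIidl/AB.
move=> n; have [mFn Fn] := mF n; split; first exact: measurableI.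
apply: le_lt_trans Fn; apply: le_measure; last exact: subIsetr.
  exact/mem_set/measurableI.
exact/mem_set.
Qed.

End uncountable_families.

(** * Stability of strong invisibility under translations and unions *)

Section invisible.
Context {R : realType}.
Implicit Types (A B M : set (measurableTypeR R)) (t : R).

Lemma measurable_translate A t :
  measurable A -> measurable [set x + t | x in A].
Proof.
move=> mA; have -> : [set x + t | x in A] =
    (fun x : measurableTypeR R => x - t) @^-1` A.
  apply/seteqP; split=> [_ [x Ax <-]|x Ax]; first by rewrite /= addrK.
  by exists (x - t) => //; rewrite subrK.
rewrite -[_ @^-1` _]setTI.
have /(_ measurableT A mA) :
    measurable_fun setT (fun x : measurableTypeR R => x - t).
  by apply: measurable_funD; [exact: measurable_id|exact: measurable_cst].
exact.
Qed.

Lemma strongly_invisible_null M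
    (mu : {measure set (measurableTypeR R) -> \bar R}) :
  strongly_invisible M -> translation_invariant mu -> sigma_finite M mu ->
  mu M = 0%E.
Proof. by move=> [_ invM] /invM[]. Qed.

Lemma strongly_invisible_translate M t :
  strongly_invisible M -> strongly_invisible [set x + t | x in M].
Proof.
move=> invM; have mM := invM.1.
split=> [|mu mu_inv]; first exact: measurable_translate.
have [[F MF mF]|] := pselect (sigma_finite [set x + t | x in M] mu);
  last by right.
left; rewrite mu_inv//; apply: strongly_invisible_null => //.
(* A cover of the translate by sets of finite measure, moved back by [- t], covers [M]. *)
exists (fun n => [set x + (- t) | x in F n]).
  rewrite -image_bigcup -MF.
  apply/seteqP; split=> [x Mx|_ [_ [x Mx <-] <-]]; last by rewrite addrK.
  by exists (x + t); [exists x|rewrite addrK].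
move=> n; have [mFn Fn] := mF n; split; first exact: measurable_translate.
by rewrite mu_inv.
Qed.

Lemma strongly_invisibleU A B :
  strongly_invisible A -> strongly_invisible B -> strongly_invisible (A `|` B).
Proof.
move=> iA iB; split=> [|mu mui]; first exact: measurableU iA.1 iB.1.
have [sAB|] := pselect (sigma_finite (A `|` B) mu); last by right.
left; apply/negligibleP; first exact: measurableU iA.1 iB.1.
apply: negligibleU; apply/negligibleP; do ?[exact: iA.1 | exact: iB.1];
  apply: strongly_invisible_null => //; apply: sigma_finite_subset sAB.
- exact: iA.1.
- exact: subsetUl.
- exact: iB.1.
- exact: subsetUr.
Qed.

End invisible.

(** * Base 3 expansions with digits 0 and 1 *)

Section ternary.
Context {R : realType}.
Implicit Types (x y : cantor_space) (n N : nat).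

Definition ternary_digit x n : R := (x n)%:R / 3 ^+ n.

(** Its range is the middle-thirds Cantor set scaled by 3/2. *)
Definition ternary x : R := limn (series (ternary_digit x)).

Lemma series_ternary_near x y n N : (forall k, (k < n)%N -> x k = y k) ->
  `|series (ternary_digit x) N - series (ternary_digit y) N| <= 3 / 2 / 3 ^+ n.
Proof.
move=> xy; pose u k := ternary_digit x k - ternary_digit y k.
have -> : series (ternary_digit x) N - series (ternary_digit y) N = series u N.
  by rewrite /series/= -sumrB.
have u0 k : (k < n)%N -> u k = 0.
  by move=> kn; rewrite /u /ternary_digit xy// subrr.
have u1 k : `|u k| <= 3^-1 ^+ k.
  rewrite /u /ternary_digit -mulrBl normrM exprVn.
  rewrite [X in _ * X]ger0_norm ?invr_ge0 ?exprn_ge0//.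
  rewrite ler_piMl ?invr_ge0 ?exprn_ge0//.
  by case: (x k); case: (y k);
    rewrite ?subrr ?subr0 ?sub0r ?normrN ?normr0 ?normr1.
have p0 k : 0 < 3^-1 ^+ k :> R by rewrite exprn_gt0.
rewrite -exprVn.
have [Nn|/ltnW/subnKC <-] := leqP N n.
  rewrite /series/= big_nat big1 ?normr0.
    by rewrite mulr_ge0// ltW.
  by move=> k /andP[_ kN]; apply: u0; exact: leq_trans kN Nn.
(* The exact partial geometric sum, unlike its limit [3 / 2 / 3 ^+ n], is a bound that goes through
   the induction. *)
suff H m : `|series u (n + m)%N| <= 3 / 2 * (3^-1 ^+ n - 3^-1 ^+ (n + m)).
  apply: (le_trans (H _)); rewrite ler_wpM2l ?lerBlDl ?lerDr ?ltW//; lra.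
elim: m => [|m IH].
  rewrite addn0 subrr mulr0 /series/= big_nat big1 ?normr0//.
rewrite addnS seriesSr; apply: le_trans (ler_normD _ _) _.
have := u1 (n + m)%N; have := p0 (n + m)%N; rewrite exprS; lra.
Qed.

Lemma series_ternary0 N : series (ternary_digit (fun=> false)) N = 0.
Proof. by rewrite /series/= big1// => k _; rewrite /ternary_digit mul0r. Qed.

Lemma is_cvg_ternary x : cvgn (series (ternary_digit x)).
Proof.
apply: nondecreasing_is_cvgn.
  apply: (@nondecreasing_series _ _ xpredT) => k _ _.
  by rewrite divr_ge0 ?exprn_ge0.
exists (3 / 2) => _ [N _ <-].
apply: le_trans (ler_norm _) _; rewrite -[X in `|X|]subr0 -(series_ternary0 N).
by rewrite -[leRHS]divr1 -(expr0 3); exact: series_ternary_near.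
Qed.

Lemma ternary0 : ternary (fun=> false) = 0.
Proof.
rewrite /ternary (_ : series _ = cst 0) ?lim_cst//.
by apply/funext => N; rewrite series_ternary0.
Qed.

Lemma ternary_near x y n : (forall k, (k < n)%N -> x k = y k) ->
  `|ternary x - ternary y| <= 3 / 2 / 3 ^+ n.
Proof.
move=> xy; rewrite /ternary -limB; do ?exact: is_cvg_ternary.
have cB := is_cvgB (@is_cvg_ternary x) (@is_cvg_ternary y).
have H N := series_ternary_near N xy.
rewrite ler_norml; apply/andP; split.
  apply: limr_ge; first exact: cB.
  by apply: nearW => N; have := H N; rewrite ler_norml => /andP[].
apply: limr_le; first exact: cB.
by apply: nearW => N; have := H N; rewrite ler_norml => /andP[].
Qed.

(** Sums of 0/1 sequences leave Cantor space, so additivity is phrased as an identity between two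
    digitwise sums. *)
Lemma ternary_add (a b c d : cantor_space) :
  (forall k, a k + b k = c k + d k)%N ->
  ternary a + ternary b = ternary c + ternary d.
Proof.
move=> abcd; rewrite /ternary -!limD; do ?exact: is_cvg_ternary.
congr (limn _); rewrite -!seriesD; congr series; apply/funext => k.
by rewrite !fctE /ternary_digit -!mulrDl -!natrD abcd.
Qed.

Lemma ternary_ge_digit x n : ternary_digit x n <= ternary x.
Proof.
have d0 k : 0 <= ternary_digit x k by rewrite divr_ge0 ?exprn_ge0.
apply: limr_ge; first exact: is_cvg_ternary.
exists n.+1 => // N /= nN; rewrite /series/= (bigD1_seq n) ?iota_uniq//=.
  by rewrite lerDl sumr_ge0.
by rewrite mem_index_iota.
Qed.

(** At the first difference [n] one digit contributes [3^-n], while the later digits can make up for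
    at most half of that. *)
Lemma ternary_inj : injective ternary.
Proof.
suff lt_ternary x y n : (forall k, (k < n)%N -> x k = y k) ->
    x n = true -> y n = false -> ternary y < ternary x.
  move=> x y txy; apply/funext; apply: contrapT => /existsNP[n0 xyn0].
  have : exists n, x n != y n by exists n0; exact/eqP.
  move=> /ex_minnP[n xyn nmin].
  have xy k : (k < n)%N -> x k = y k.
    by move=> kn; apply/eqP; apply: contraTT kn => /nmin; rewrite -leqNgt.
  case xnE: (x n) xyn; case ynE: (y n) => // _.
    by have := lt_ternary x y n xy xnE ynE; rewrite txy ltxx.
  have := lt_ternary y x n (fun k kn => esym (xy k kn)) ynE xnE.
  by rewrite txy ltxx.
(* [x'] is [x] with digit [n] cleared, so it agrees with [y] up to and including [n]; [e] is the
   cleared digit. *)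
move=> xy xn yn; pose x' : cantor_space := fun k => (k != n) && x k.
pose e : cantor_space := fun k => k == n.
have : ternary x + ternary (fun=> false) = ternary x' + ternary e.
  apply: ternary_add => k; rewrite /x' /e.
  by case: eqVneq => [->|] /=; rewrite ?xn ?addn0.
have : `|ternary x' - ternary y| <= 3 / 2 / 3 ^+ n.+1.
  apply: ternary_near => k; rewrite ltnS leq_eqVlt /x' => /orP[/eqP ->|kn].
    by rewrite eqxx yn.
  by rewrite (ltn_eqF kn) xy.
have := ternary_ge_digit e n; rewrite /ternary_digit /e eqxx ternary0 mul1r.
have p0 : 0 < (3 ^+ n)^-1 :> R by rewrite invr_gt0 exprn_gt0.
rewrite exprS invfM ler_norml => ? /andP[]; lra.
Qed.

Lemma nbhs_prefix x n :
  nbhs x [set y : cantor_space | forall k, (k < n)%N -> x k = y k].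
Proof.
elim: n => [|n IH]; first by apply: filterS filterT => y _ k.
have xn : nbhs x [set y : cantor_space | x n = y n].
  have := @proj_continuous nat (fun=> bool) n x.
  move/(_ [set b | x n = b]); apply.
  by apply: open_nbhs_nbhs; split => //; exact: discrete_open.
apply: filterS2 IH xn => y yn yn1 k; rewrite ltnS leq_eqVlt => /orP[/eqP ->//|].
exact: yn.
Qed.

Lemma ternary_small (e : R) : 0 < e -> exists n, 3 / 2 / 3 ^+ n < e.
Proof.
move=> e0; have /cvgrPdist_lt/(_ _ e0)[n _ /(_ n (leqnn n))] :
    geometric (3 / 2) (3^-1) @ \oo --> (0 : R).
  by apply: cvg_geometric; rewrite ger0_norm//; lra.
rewrite /geometric/= sub0r normrN exprVn => /(le_lt_trans (ler_norm _)).
by exists n.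
Qed.

Lemma ternary_continuous : continuous ternary.
Proof.
move=> x; apply/cvgrPdist_lt => e /ternary_small[n ne].
apply: filterS (nbhs_prefix x n) => y xy; apply: le_lt_trans ne.
exact: ternary_near.
Qed.

End ternary.

Lemma closed_coordinate n (A : set bool) :
  closed [set x : cantor_space | A (x n)].
Proof.
have cn := @proj_continuous nat (fun=> bool) n.
rewrite (_ : mkset _ = proj n @^-1` A)//.
by apply: preimage_closed => [x _|]; [exact: cn|exact: discrete_closed].
Qed.

(** * Sparse sequences, their cells and shifts *)

Section sparse.
Context {R : realType}.
Implicit Types (x y : cantor_space) (n N k l : nat).

(* Taking for k the first nonzero position of x, the condition says that it is
   at least N and larger than the 2-adic valuation of every position l of the
   support; quantifying over all k instead makes the set visibly closed. *)
Definition sparse N : set cantor_space :=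
  [set x | forall k l, x k -> x l -> (N <= k)%N /\ (logn 2 l < k)%N].

(** With [true], the first nonzero position is [n]; the cells with [false] serve to catch the zero
    sequence. *)
Definition sparse_cell n (b : bool) : set cantor_space :=
  [set x | x n = b /\ forall l, x l -> (n <= l)%N /\ (logn 2 l < n)%N].

(* The k with [logn 2 k = n] are the [2 ^ n * (2 i + 1)], and then
   [k %/ 2 ^ n.+1 = i]: the sequence [y] is written along these k. *)
Definition sparse_shift n x y : cantor_space :=
  fun k => (n < k)%N && (if logn 2 k == n then y (k %/ 2 ^ n.+1)%N else x k).

Lemma closed_sparse N : closed (sparse N).
Proof.
have -> : sparse N = \bigcap_k \bigcap_l
    [set x : cantor_space | x k -> x l -> (N <= k)%N /\ (logn 2 l < k)%N].
  by apply/seteqP; split=> x /= H; [move=> k _ l _|move=> k l]; exact: H.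
apply: closed_bigI => k _; apply: closed_bigI => l _.
(* For fixed [k] and [l] the condition is either vacuous or says that one of two digits vanishes. *)
have [kl|nkl] := pselect ((N <= k)%N /\ (logn 2 l < k)%N).
  rewrite (_ : mkset _ = setT); first exact: closedT.
  by apply/seteqP; split=> // x _ /= _ _.
have -> : [set x : cantor_space |
      x k -> x l -> (N <= k)%N /\ (logn 2 l < k)%N] =
    [set x | x k = false] `|` [set x | x l = false].
  apply/seteqP; split=> x /=; last by move=> [->|->].
  case: (x k) => [|_]; last by left.
  by case: (x l) => [/(_ isT isT)/nkl|_]; last by right.
by apply: closedU; [exact: (@closed_coordinate k [set b | b = false])|
                    exact: (@closed_coordinate l [set b | b = false])].
Qed.

Lemma closed_sparse_cell n b : closed (sparse_cell n b).
Proof.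
have -> : sparse_cell n b = [set x | x n = b] `&`
    \bigcap_l [set x : cantor_space | x l -> (n <= l)%N /\ (logn 2 l < n)%N].
  apply/seteqP; split=> x /= [xn H]; split => // l; first by move=> _; exact: H.
  exact: H.
apply: closedI; first exact: (@closed_coordinate n [set c | c = b]).
apply: closed_bigI => l _.
exact: (@closed_coordinate l
  [set c : bool | c -> (n <= l)%N /\ (logn 2 l < n)%N]).
Qed.

Lemma sparse_cell_subset N n b : (N <= n)%N -> sparse_cell n b `<=` sparse N.
Proof.
move=> Nn x [_ xn] k l /xn[nk _] /xn[_ ln]; split; first exact: leq_trans nk.
exact: leq_trans nk.
Qed.

Lemma sparseE N : sparse N =
  \bigcup_n (sparse_cell (N + n) true `|` sparse_cell (N + n) false).
Proof.
apply/seteqP; split=> [x xN|x [n _]]; last first.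
  by case; apply: sparse_cell_subset; exact: leq_addr.
have [x0|] := pselect (forall n, x n = false).
  by exists 0%N => //; right; split=> // l; rewrite x0.
move=> /existsNP[n0 xn0].
have : exists n, x n by exists n0; case: (x n0) xn0.
move=> /ex_minnP[n xn nmin]; exists (n - N)%N => //; left.
rewrite subnKC; last exact: (xN n n xn xn).1.
by split=> // l xl; split; [exact: nmin|exact: (xN n l xn xl).2].
Qed.

(** The new support lies beyond [n], and its valuations are at most [n]: equal to [n] where [y] is
    written, smaller where [x] is kept. *)
Lemma sparse_shift_sparse N n b x y : (N <= n)%N -> sparse_cell n b x ->
  sparse N (sparse_shift n x y).
Proof.
move=> Nn [_ xn] k l /andP[nk _] /andP[nl zl].
split; first exact: leq_trans (ltnW nk).
by apply: leq_ltn_trans nk; case: eqP zl => [<-//|_ /xn[_ /ltnW]].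
Qed.

Lemma sparse_shift_inj n x x' y y' :
  sparse_shift n x y = sparse_shift n x' y' -> y = y'.
Proof.
(* The digit [y i] is read back at position [2 ^ n * (2 i + 1)], which exceeds [n] and hence is not
   cleared. *)
move=> zz; apply/funext => i; have := congr1 (@^~ (2 ^ n * (i.*2.+1))%N) zz.
have lgn : logn 2 (2 ^ n * i.*2.+1) = n.
  rewrite lognM ?expn_gt0// pfactorK// -[RHS]addn0; congr addn.
  by rewrite lognE /= dvdn2 /= odd_double.
rewrite /sparse_shift lgn eqxx.
have -> : ((2 ^ n * i.*2.+1) %/ 2 ^ n.+1 = i)%N.
  by rewrite expnSr divnMl ?expn_gt0// divn2 /= uphalf_double.
have -> // : (n < 2 ^ n * i.*2.+1)%N.
by apply: leq_trans (ltn_expl n (ltnSn 1)) _; rewrite leq_pmulr.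
Qed.

(** Value of the inserted digits minus that of the cleared one; no [x] occurs, so the shift acts on
    a cell as a translation. *)
Definition sparse_gap n (b : bool) y : R :=
  ternary (fun k => [&& (n < k)%N, logn 2 k == n & y (k %/ 2 ^ n.+1)%N]) -
  ternary (fun k => (k == n) && b).

Lemma ternary_shift n b x y : sparse_cell n b x ->
  ternary (sparse_shift n x y) = ternary x + sparse_gap n b y.
Proof.
move=> [xn xP]; rewrite /sparse_gap addrA; apply/eqP; rewrite -subr_eq opprK.
apply/eqP; apply: ternary_add => k; rewrite /sparse_shift.
(* Beyond [n], the digits of [y] only land where [x] vanishes, since its support has valuations
   below [n]. *)
case: (ltngtP n k) => [nk|kn|<-] /=; last by rewrite xn addn0.
  case: eqP => [lk|_]; last by case: (x k).
  have -> : x k = false by apply/negP => /xP[_]; rewrite lk ltnn.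
  by rewrite addn0.
by have -> : x k = false by apply/negP => /xP[]; rewrite leqNgt kn.
Qed.

Lemma compact_ternary_image (A : set cantor_space) :
  closed A -> compact (ternary @` A : set R).
Proof.
move=> cA; apply: continuous_compact.
  by apply: continuous_subspaceT; exact: ternary_continuous.
exact: (subclosed_compact cA cantor_space_compact).
Qed.

Lemma measurable_ternary_image (A : set cantor_space) :
  closed A -> measurable (ternary @` A : set (measurableTypeR R)).
Proof.
by move=> cA; apply: compact_measurable; exact: compact_ternary_image.
Qed.

Lemma sparse_cell_null N n b
    (mu : {measure set (measurableTypeR R) -> \bar R}) :
  (N <= n)%N -> translation_invariant mu ->
  sigma_finite (ternary @` sparse N : set (measurableTypeR R)) mu ->
  mu (ternary @` sparse_cell n b) = 0%E.
Proof.
move=> Nn mu_inv sf.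
have mD := measurable_ternary_image (@closed_sparse_cell n b).
pose A y : set (measurableTypeR R) :=
  [set x + sparse_gap n b y | x in ternary @` sparse_cell n b].
have AP y z : A y z ->
    exists2 x, sparse_cell n b x & z = ternary (sparse_shift n x y).
  by move=> [_ [x xD <-] <-]; exists x => //; rewrite (ternary_shift y xD).
have [//|||y Ay0] := @uncountable_disjoint_null _ _ R mu cantor_space A _
    uncountable_cantor_space _ _ _ sf.
- by move=> y; exact: measurable_translate.
(* A common point determines the shifted sequence, which determines [y] even when the underlying [x]
   and [x'] differ. *)
- move=> y y' _ _ [z [/AP[x _ ->] /AP[x' _ /ternary_inj/sparse_shift_inj]]].
  exact.
- move=> y z /AP[x xD ->]; exists (sparse_shift n x y) => //.
  exact: sparse_shift_sparse xD.
- by move: Ay0; rewrite mu_inv.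
Qed.

Lemma strongly_invisible_sparse N :
  strongly_invisible (ternary @` sparse N : set (measurableTypeR R)).
Proof.
have mM := measurable_ternary_image (@closed_sparse N).
split=> // mu mu_inv.
have [sf|] := pselect
  (sigma_finite (ternary @` sparse N : set (measurableTypeR R)) mu);
  last by right.
left; apply: measure_negligible => //.
rewrite [in X in _ X]sparseE image_bigcup; apply: negligible_bigcup => n.
rewrite image_setU; apply: negligibleU; apply/negligibleP;
  do ?[by apply: measurable_ternary_image; exact: closed_sparse_cell];
  exact: (sparse_cell_null _ (leq_addr n N)).
Qed.

End sparse.

(** * Approximation of compact sets *)

Lemma strongly_invisible_small (R : realType) (e : R) : 0 < e ->
  exists M : set R, [/\ compact M, strongly_invisible M, M 0 &
    forall x, M x -> `|x| < e].
Proof.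
move=> /ternary_small[N Ne]; exists (ternary @` sparse N); split.
- exact/compact_ternary_image/closed_sparse.
- exact: strongly_invisible_sparse.
- by exists (fun=> false); rewrite ?ternary0.
(* Sparse sequences vanish before [N], so they agree there with the zero sequence. *)
move=> _ [x xN <-]; apply: le_lt_trans Ne.
rewrite -[X in `|X|]subr0 -(ternary0 (R := R)); apply: ternary_near => k kN.
by apply/negP => xk; have [] := xN k k xk xk; rewrite leqNgt kN.
Qed.

Lemma compact_finite_net (R : realType) (K : set R) (e : R) :
  compact K -> 0 < e ->
  exists2 s : seq R, (forall c, c \in s -> K c) &
    forall x, K x -> exists2 c, c \in s & `|x - c| < e.
Proof.
rewrite compact_cover => cK e0.
have [| |D DK KD] := cK R K (fun c => ball c e).
- by move=> c _; exact: ball_open.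
- by move=> x Kx; exists x => //; exact: ballxx.
exists (enum_fset D) => [c /DK/set_mem//|x /KD[c cD cx]].
by exists c => //; rewrite distrC.
Qed.

Theorem proposition4p3 (R : realType) :
  dense [set K : compacts R | strongly_invisible K].
Proof.
move=> O [K OK] oO.
have /nbhs_ballP[e /= e0 eO] : nbhs K O by exact: open_nbhs_nbhs.
have e20 : 0 < e / 2 by rewrite divr_gt0.
have [s sK Ks] := compact_finite_net (@compacts_compact _ K) e20.
have [M [cM iM M0 Me]] := strongly_invisible_small e20.
(* A copy of [M] is attached to each point of the net; since [M] contains 0, [L] contains the
   net. *)
pose L : set R := \big[setU/set0]_(c <- s) [set x + c | x in M].
have LE x : L x <-> exists2 c, c \in s & exists2 y, M y & y + c = x.
  by rewrite /L -bigcup_seq; split=> -[c cs Mc]; exists c.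
have cL : compact L.
  apply: bigsetU_compact => c _; apply: continuous_compact => //.
  apply: continuous_subspaceT => x.
  by apply: cvgD; [exact: cvg_id|exact: cvg_cst].
have L0 : L !=set0.
  have [x Kx] := compacts_neq0 K; have [c cs _] := Ks x Kx.
  by exists c; apply/LE; exists c => //; exists 0; rewrite ?add0r.
have iL : strongly_invisible L.
  rewrite /L; elim/big_ind : _ => [|A B|c _].
  - by split=> [|mu _]; [exact: measurable0|left; rewrite measure0].
  - exact: strongly_invisibleU.
  - exact: strongly_invisible_translate.
exists (Compacts cL L0); split=> //; apply: eO.
(* The net and [M] were taken at scale [e / 2] because pointwise estimates bound the Hausdorff
   distance only non-strictly. *)
rewrite ballEmdist /=; apply: (@le_lt_trans _ _ (e / 2)); last lra.
apply/hausdorff_dist_leP; split=> [x Kx|x /LE[c cs [y My <-]]].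
  have [c cs xc] := Ks x Kx.
  apply: le_trans (ltW xc); apply: (@dist_to_set_le _ _ _ (Compacts cL L0)).
  by apply/LE; exists c => //; exists 0; rewrite ?add0r.
apply: le_trans (dist_to_set_le _ (sK c cs)) _.
by rewrite addrK ltW// Me.
Qed.
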